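(* Assume the standing hypotheses (A1)–(A4) on $\varphi,\psi,g,h$ and the conditions (D) on the data $(\alpha_0,\beta_0,\gamma_0,v_0)\in X$ stated in the context. Then the minimizer $(\alpha,\beta,\gamma,v)\in\mathcal{A}_\lambda$ of $I$ over $\mathcal{A}_\lambda$ is unique.
   Context: Constants: $1<p,q<\infty$, $\lambda>0$, time step $\tau>0$. All functions of $\rho$ live on $(0,1)$, and $'$ denotes the (weak) derivative in $\rho$ (or the ordinary derivative for $\varphi,\psi,g,h$). $\mathbb{R}_+=(0,\infty)$. Constitutive functions $\varphi,g:\mathbb{R}\to\mathbb{R}$, $h:\mathbb{R}_+\to\mathbb{R}$, and $\psi(x)=\varphi(x^{1/3})$ for $x\in\mathbb{R}$ (real cube root), satisfy: (A1) $\lim_{\delta\to0+}h(\delta)=\lim_{\delta\to+\infty}h(\delta)/\delta=+\infty$; (A2) $\varphi,\psi,g\in C^2(\mathbb{R})$, $h\in C^2(\mathbb{R}_+)$, $\varphi,\psi,g,h,\varphi'',\psi'',g''\ge0$ and $h''>0$; (A3) for some constants $c_1,c_2>0$, $\lim_{|x|\to\infty}\frac{\varphi(x)}{|x|^{3p}}=\lim_{|x|\to\infty}\frac{\psi(x)}{|x|^p}=c_1$ and $\lim_{|x|\to\infty}\frac{g(x)}{|x|^q}=c_2$; (A4) for some constants $C_1,C_2,C_3>0$, $\limsup_{|x|\to\infty}\frac{|\varphi'(x)|}{|x|^{3p-1}}\le C_1$, $\limsup_{|x|\to\infty}\frac{|\psi'(x)|}{|x|^{p-1}}\le C_2$, $\limsup_{|x|\to\infty}\frac{|g'(x)|}{|x|^{q-1}}\le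 C_3$. Function spaces: $X_1=\{f\in W^{1,1}(0,1): f/\rho\in L^p(0,1)\}$, $X_2=\{f\in L^1_{loc}(0,1): f\rho^{2/3}\in L^{3p}(0,1)\}$, $X_3=\{f\in W^{1,1}_{loc}(0,1): f/\rho^{2/3}\in L^q(0,1),\ f'\rho^{1/3}\in L^q(0,1)\}$, $Y=\{f\in W^{1,1}_{loc}(0,1): f\in L^2(0,1),\ f'\rho^{2/3}\in L^{3p}(0,1)\}$, $X=X_1\times X_2\times X_3\times Y$. Values such as $\alpha(0),\alpha(1)$ refer to the continuous representative; functions are identified when equal a.e. Energy density: for $(\alpha,\beta,\gamma)$ with $\alpha'>0$ a.e., $$E(\alpha,\beta,\gamma)(\rho)=\varphi(\beta\rho^{2/3})+2\psi(\alpha/\rho)+g(\gamma/\rho^{2/3})+2g\big(\tfrac32\gamma'\rho^{1/3}\big)+h(\alpha').$$ Data conditions (D): $(\alpha_0,\beta_0,\gamma_0,v_0)\in X$, $\alpha_0(1)=\lambda$, $\alpha_0\ge0$, $\alpha_0'>0$ a.e. on $(0,1)$, and $\int_0^1\big(\tfrac12v_0^2+E(\alpha_0,\beta_0,\gamma_0)\big)d\rho<\infty$. Functional: $I(\alpha,\beta,\gamma,v)=\int_0^1\big(\tfrac12(v-v_0)^2+E(\alpha,\beta,\gamma)\big)d\rho\in[0,\infty]$ for $(\alpha,\beta,\gamma,v)\in X$ with $\alpha'>0$ a.e. Admissible set: $\mathcal{A}_\lambda$ is the set of $(\alpha,\beta,\gamma,v)\in X$ such that $\alpha(0)\ge0$,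 $\alpha(1)=\lambda$, $\alpha'>0$ a.e., $I(\alpha,\beta,\gamma,v)<\infty$, and $$\frac{\beta-\beta_0}{\tau}=3v',\qquad \frac{\alpha-\alpha_0}{\tau}=3\alpha_0^{2/3}v,\qquad \frac{\gamma-\gamma_0}{\tau}=2\alpha_0^{1/3}v.$$ *)

(* Defs.v *)
From HB Require Import structures.
From mathcomp Require Export all_boot all_order all_algebra.
From mathcomp Require Export all_classical all_reals all_analysis.

Set Implicit Arguments.
Unset Strict Implicit.
Unset Printing Implicit Defensive.

Import Order.TTheory GRing.Theory Num.Theory.
Import numFieldNormedType.Exports.

Local Open Scope classical_set_scope.
Local Open Scope ring_scope.

(* Functions on (0,1) are total functions [R -> R] of which only the values on
   `]0, 1[ matter, up to Lebesgue-negligible sets. *)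

Section function_spaces.
Context {R : realType}.
Local Notation mu := (@lebesgue_measure R).
Implicit Types (f df t : R -> R) (s x l : R).

(* Membership in L^s(0,1); the restriction [f \_ `]0, 1[] is zero outside (0,1). *)
Definition Lp01 s f : Prop := (f \_ `]0, 1[) \in Lfun mu s%:E.

Definition L1loc01 f : Prop := locally_integrable `]0, 1[ f.

Definition test_function t : Prop :=
  [/\ forall n x, derivable (derive1n n t) x 1,
      compact (closure [set x | t x != 0]) &
      closure [set x | t x != 0] `<=` `]0, 1[].

Definition is_weak_derivative f df : Prop :=
  [/\ L1loc01 f, L1loc01 df &
      forall t, test_function t ->
        \int[mu]_(x in `]0, 1[) (f x * derive1 t x)
        = - \int[mu]_(x in `]0, 1[) (df x * t x)].

Definition W11loc01 f : Prop := exists df, is_weak_derivative f df.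

(* A representative of the weak derivative (which is unique up to a.e.
   equality); junk value 0 when [f] is not in W^{1,1}_loc(0,1). *)
Definition wderiv f : R -> R := xget (cst 0) [set df | is_weak_derivative f df].

Definition W1101 f : Prop := [/\ W11loc01 f, Lp01 1 f & Lp01 1 (wderiv f)].

(* [l] is the value at [x] (in [0,1]) of the continuous representative of [f]. *)
Definition boundary_value f x l : Prop :=
  exists fc : R -> R, [/\ {within `[0, 1], continuous fc},
    fc = f %[ae mu in `]0, 1[%classic] & fc x = l].

Definition spaceX1 (p : R) f : Prop :=
  W1101 f /\ Lp01 p (fun r => f r / r).

Definition spaceX2 (p : R) f : Prop :=
  L1loc01 f /\ Lp01 (3 * p) (fun r => f r * r `^ (2 / 3)).

Definition spaceX3 (q : R) f : Prop :=
  [/\ W11loc01 f, Lp01 q (fun r => f r / r `^ (2 / 3)) &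
      Lp01 q (fun r => wderiv f r * r `^ (1 / 3))].

Definition spaceY (p : R) f : Prop :=
  [/\ W11loc01 f, Lp01 2 f &
      Lp01 (3 * p) (fun r => wderiv f r * r `^ (2 / 3))].

End function_spaces.

Record fields (R : realType) := Fields {
  alpha : R -> R;
  beta : R -> R;
  gamma : R -> R;
  vel : R -> R }.

Section constitutive_functions.
Context {R : realType}.

(* The real cube root; [powR] is only meaningful on nonnegative bases. *)
Definition cbrt (x : R) : R := Num.sg x * `|x| `^ (1 / 3).

(* The filter of the limit |x| -> oo on the real line. *)
Definition abs_infty : set_system R :=
  filter_from setT (fun M : R => [set x | M < `|x|]).

#[global] Instance abs_infty_filter : ProperFilter abs_infty.
Proof.
apply: filter_from_proper; last first.
  move=> M _; exists (`|M| + 1) => /=.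
  by rewrite (lt_le_trans _ (ler_norm _))// (le_lt_trans (ler_norm M))// ltrDl.
apply: filter_from_filter; first by exists 0.
move=> M N _ _; exists (Num.max M N) => // x /=.
by rewrite gt_max => /andP[].
Qed.

Definition C2_on (D : set R) (f : R -> R) : Prop :=
  forall x, D x ->
    [/\ derivable f x 1, derivable (derive1 f) x 1 &
        {for x, continuous (derive1n 2 f)}].

(* Only the values of [h] on (0,+oo) matter. *)
Record constitutive (p q : R) (phi psi g h : R -> R) : Prop := Constitutive {
  psi_def : forall x, psi x = phi (cbrt x);
  A1_zero : h x @[x --> 0^'+] --> +oo;
  A1_infty : h x / x @[x --> +oo] --> +oo;
  A2_smooth : [/\ C2_on setT phi, C2_on setT psi, C2_on setT g &
                  C2_on `]0, +oo[ h];
  A2_ge0 : [/\ forall x, 0 <= phi x, forall x, 0 <= psi x,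
               forall x, 0 <= g x & forall x, 0 < x -> 0 <= h x];
  A2_convex : [/\ forall x, 0 <= derive1n 2 phi x,
                  forall x, 0 <= derive1n 2 psi x,
                  forall x, 0 <= derive1n 2 g x &
                  forall x, 0 < x -> 0 < derive1n 2 h x];
  A3 : exists c1 c2 : R, [/\ 0 < c1, 0 < c2,
         phi x / `|x| `^ (3 * p) @[x --> abs_infty] --> c1,
         psi x / `|x| `^ p @[x --> abs_infty] --> c1 &
         g x / `|x| `^ q @[x --> abs_infty] --> c2];
  A4 : exists C1 C2 C3 : R, [/\ [/\ 0 < C1, 0 < C2 & 0 < C3],
         (limf_esup (fun x => (`|derive1 phi x| / `|x| `^ (3 * p - 1))%:E)
            abs_infty <= C1%:E)%E,
         (limf_esup (fun x => (`|derive1 psi x| / `|x| `^ (p - 1))%:E)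
            abs_infty <= C2%:E)%E &
         (limf_esup (fun x => (`|derive1 g x| / `|x| `^ (q - 1))%:E)
            abs_infty <= C3%:E)%E] }.

End constitutive_functions.

Section variational_problem.
Context {R : realType}.
Local Notation mu := (@lebesgue_measure R).
Variables (p q lambda tau : R) (phi psi g h : R -> R).

Definition spaceX (u : fields R) : Prop :=
  [/\ spaceX1 p (alpha u), spaceX2 p (beta u), spaceX3 q (gamma u) &
      spaceY p (vel u)].

Definition ae_pos (f : R -> R) : Prop :=
  \forall r \ae mu, r \in `]0, 1[ -> 0 < f r.

(* [h] lives on (0,+oo) and is extended by 0; the extension is irrelevant when
   the weak derivative of [a] is positive a.e. *)
Definition energy (a b c : R -> R) (r : R) : R :=
  phi (b r * r `^ (2 / 3)) + 2 * psi (a r / r) + g (c r / r `^ (2 / 3))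
  + 2 * g (3 / 2 * wderiv c r * r `^ (1 / 3))
  + (h \_ `]0, +oo[) (wderiv a r).

Definition data_conditions (u0 : fields R) : Prop :=
  [/\ spaceX u0,
      boundary_value (alpha u0) 1 lambda,
      \forall r \ae mu, r \in `]0, 1[ -> 0 <= alpha u0 r,
      ae_pos (wderiv (alpha u0)) &
      (\int[mu]_(r in `]0%R, 1%R[)
         (1 / 2 * (vel u0 r) ^+ 2
          + energy (alpha u0) (beta u0) (gamma u0) r)%:E < +oo)%E].

Definition functional (u0 u : fields R) : \bar R :=
  (\int[mu]_(r in `]0%R, 1%R[)
     (1 / 2 * (vel u r - vel u0 r) ^+ 2
      + energy (alpha u) (beta u) (gamma u) r)%:E)%E.

Definition admissible (u0 u : fields R) : Prop :=
  [/\ spaceX u,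
      (exists2 a0 : R, boundary_value (alpha u) 0 a0 & 0 <= a0)
      /\ boundary_value (alpha u) 1 lambda,
      ae_pos (wderiv (alpha u)),
      (functional u0 u < +oo)%E &
      [/\ (fun r => (beta u r - beta u0 r) / tau)
            = (fun r => 3 * wderiv (vel u) r) %[ae mu in `]0, 1[%classic],
          (fun r => (alpha u r - alpha u0 r) / tau)
            = (fun r => 3 * alpha u0 r `^ (2 / 3) * vel u r)
              %[ae mu in `]0, 1[%classic] &
          (fun r => (gamma u r - gamma u0 r) / tau)
            = (fun r => 2 * alpha u0 r `^ (1 / 3) * vel u r)
              %[ae mu in `]0, 1[%classic]]].

Definition minimizer (u0 u : fields R) : Prop :=
  admissible u0 u /\
  forall w, admissible u0 w -> (functional u0 u <= functional u0 w)%E.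

End variational_problem.

(* Equality of classes of functions on (0,1), componentwise. *)
Definition ae_eq_fields {R : realType} (u w : fields R) : Prop :=
  [/\ alpha u = alpha w %[ae lebesgue_measure in `]0, 1[%classic],
      beta u = beta w %[ae lebesgue_measure in `]0, 1[%classic],
      gamma u = gamma w %[ae lebesgue_measure in `]0, 1[%classic] &
      vel u = vel w %[ae lebesgue_measure in `]0, 1[%classic]].

(* Main.v *)
(* The midpoint of two admissible states is admissible, because the constraints
   are linear in the unknowns.  The energy density is convex and the kinetic
   term is quadratic, so the value of the functional at the midpoint is at most
   the mean of its two values minus the integral of |v_u - v_w|^2 / 8; hence two
   minimizers have the same velocity, and the constraints then determine the
   other components.  Weak derivatives are chosen representatives, so already
   their linearity requires the fundamental lemma of the calculus of variations.
   As test functions one may take exp(- c / (x - a)) exp(- c / (b - x)), extended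
   by 0 outside ]a, b[, which tend boundedly to the indicator of ]a, b[ when c
   tends to 0; no mollification is needed. *)
Require Import Defs.
From mathcomp Require Import all_boot all_order all_algebra.
From mathcomp Require Import all_classical all_reals all_analysis.
From mathcomp Require Import measurable_realfun ring lra.

Set Implicit Arguments.
Unset Strict Implicit.
Unset Printing Implicit Defensive.

Import Order.TTheory GRing.Theory Num.Theory.
Import numFieldNormedType.Exports.
Local Open Scope classical_set_scope.
Local Open Scope ring_scope.

(** * Smooth bumps built from exp(- c / x) *)

Section smooth_bump.
Context {R : realType}.
Implicit Types (c x a b : R) (k l n : nat).

(** The factor [x^-1 ^+ k] is there because differentiating exp(- c / x) brings out negative powers
    of x; the span of the family over all [k] is then stable under derivation. *)
Definition flat_exp c k x : R :=
  if 0 < x then x^-1 ^+ k * expR (- (c / x)) else 0.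

Lemma flat_exp_pos c k x : 0 < x ->
  flat_exp c k x = x^-1 ^+ k * expR (- (c / x)).
Proof. by rewrite /flat_exp => ->. Qed.

Lemma flat_exp_neg c k x : x <= 0 -> flat_exp c k x = 0.
Proof. by rewrite /flat_exp ltNge => ->. Qed.

(** The exponential series gives y^(k+1) / (k+1)! <= exp y, used at y = c / x. The bound yields
    continuity at the gluing point 0. *)
Lemma flat_exp_lipschitz0 c k : 0 < c ->
  exists M, forall x, `|flat_exp c k x| <= M * `|x|.
Proof.
move=> c0; exists (k.+1`!%:R / c ^+ k.+1) => x.
have [x0|x0] := ltP 0 x; last first.
  by rewrite flat_exp_neg// normr0 mulr_ge0// divr_ge0 ?ler0n// exprn_ge0// ltW.
have cx0 : 0 < c / x by rewrite divr_gt0.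
rewrite flat_exp_pos// (gtr0_norm x0).
rewrite ger0_norm; last first.
  by rewrite mulr_ge0 ?expR_ge0// exprn_ge0// invr_ge0 ltW.
rewrite expRN ler_pdivrMr ?expR_gt0//.
have := expR_ge1Dxn k (ltW cx0).
set F := k.+1`!%:R; set E := expR _ => EF.
have F0 : 0 < F :> R by rewrite ltr0n fact_gt0.
have {EF} : (c / x) ^+ k.+1 / F <= E by apply: le_trans EF; rewrite lerDr.
rewrite -(ler_pM2l (x := F / c ^+ k.+1 * x)); last first.
  by rewrite mulr_gt0// divr_gt0 ?exprn_gt0.
apply: le_trans; rewrite le_eqVlt; apply/orP; left; apply/eqP.
rewrite !exprMn !exprS !exprVn.
by field; rewrite ?expf_neq0 ?gt_eqF.
Qed.

Lemma is_derive_flat_exp c k x : 0 < c ->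
  is_derive x 1 (flat_exp c k)
    (c * flat_exp c k.+2 x - k%:R * flat_exp c k.+1 x).
Proof.
move=> c0; have [x0|x0|->] := ltgtP x 0.
- rewrite !flat_exp_neg ?ltW// !mulr0 subr0.
  apply: (@near_eq_is_derive _ _ _ (cst 0)).
  near=> y; rewrite flat_exp_neg//=.
  by apply: ltW; near: y; exact: lt_nbhsl.
- rewrite !flat_exp_pos//.
  have dV : is_derive x 1 (fun y : R => y^-1) (- x ^- 2 *: 1).
    by apply: is_deriveV; rewrite ?gt_eqF.
  suff : is_derive x 1
      ((fun y => y^-1) ^+ k * (expR \o (fun y => - (c *: y^-1))))
      (c * (x^-1 ^+ k.+2 * expR (- (c / x)))
       - k%:R * (x^-1 ^+ k.+1 * expR (- (c / x)))).
    apply: near_eq_is_derive; near=> y; rewrite flat_exp_pos ?fctE//.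
    by near: y; exact: lt_nbhsr.
  apply: is_derive_eq.
  rewrite exprfctE /= /GRing.scale/= mulr1 !exprS.
  case: k => [|k] /=; first by rewrite !expr0; field; rewrite gt_eqF.
  by rewrite !exprS !exprVn; field; rewrite ?expf_neq0 gt_eqF.
- rewrite !flat_exp_neg ?lexx// !mulr0 subr0.
  have [M hM] := flat_exp_lipschitz0 k.+1 c0.
  (* The difference quotient of [flat_exp c k] at 0 is [flat_exp c k.+1], which tends to 0 by the
     linear bound. *)
  apply/is_derive1_caratheodory; exists (flat_exp c k.+1); split.
  + move=> z; rewrite (@flat_exp_neg _ _ 0)// !subr0.
    have [z0|z0] := ltP 0 z; last by rewrite !flat_exp_neg ?mul0r.
    by rewrite !flat_exp_pos// exprS; field; rewrite gt_eqF.
  + rewrite /prop_for/= /continuous_at flat_exp_neg//.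
    apply/norm_cvg0P; apply: (@squeeze_cvgr _ _ _ _ (cst 0) (fun y => M * `|y|)).
    * by near=> y; rewrite /= normr_ge0 hM.
    * exact: cvg_cst.
    * have : M * `|y| @[y --> (0 : R)] --> M * `|0 : R|.
        by apply: cvgMr; apply: cvg_norm; exact: cvg_id.
      by rewrite normr0 mulr0.
  + by rewrite flat_exp_neg.
Unshelve. all: by end_near. Qed.

Definition bump c a b x : R := flat_exp c 0 (x - a) * flat_exp c 0 (b - x).

(* The span of these products is stable under derivation, hence the smoothness
   of [bump c a b]. *)
Inductive flat_span c a b : (R -> R) -> Prop :=
| flat_span_prod k l :
    flat_span c a b (fun x => flat_exp c k (x - a) * flat_exp c l (b - x))
| flat_span_lin (r s : R) f g : flat_span c a b f -> flat_span c a b g ->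
    flat_span c a b (r *: f + s *: g).

Lemma flat_span_derive c a b f : 0 < c -> flat_span c a b f ->
  (forall x, derivable f x 1) /\ flat_span c a b (derive1 f).
Proof.
move=> c0; elim=> {f} [k l|r s f g _ [df sf] _ [dg sg]].
- pose P k l x := flat_exp c k (x - a) * flat_exp c l (b - x).
  (* Each factor contributes two products, with its exponent raised by two and by one; the minus
     sign is the inner derivative of [b - y]. *)
  have dP x : is_derive x 1 (P k l)
      ((c *: P k.+2 l + (- k%:R) *: P k.+1 l) x
       - (c *: P k l.+2 + (- l%:R) *: P k l.+1) x).
    have d1 : is_derive (x - a) 1 (flat_exp c k) _ :=
      is_derive_flat_exp k (x - a) c0.
    have d2 : is_derive (b - x) 1 (flat_exp c l) _ :=
      is_derive_flat_exp l (b - x) c0.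
    have e1 : is_derive x 1 (fun y : R => y - a) 1.
      by apply: is_derive_eq; rewrite subr0.
    have e2 : is_derive x 1 (fun y : R => b - y) (-1).
      by apply: is_derive_eq; rewrite add0r mul1r.
    have := is_deriveM (@is_derive1_comp _ _ (fun y => y - a) _ _ _ d1 e1)
      (@is_derive1_comp _ _ (fun y => b - y) _ _ _ d2 e2).
    move=> H; apply: (is_derive_eq H).
    have scE (r s : R) : r *: s = r * s by [].
    by rewrite /P !fctE/= !scE; ring.
  split => [x|]; first by case: (dP x).
  have -> : derive1 (P k l) = 1 *: (c *: P k.+2 l + (- k%:R) *: P k.+1 l)
     + (-1) *: (c *: P k l.+2 + (- l%:R) *: P k l.+1).
    apply/funext => x; rewrite derive1E.
    by have [_ ->] := dP x; rewrite !fctE/= scale1r scaleN1r.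
  by do 2 apply: flat_span_lin; exact: flat_span_prod.
- split => [x|].
    by apply: derivableD; apply: derivableZ.
  have -> : derive1 (r *: f + s *: g) = r *: derive1 f + s *: derive1 g.
    apply/funext => x; rewrite derive1E deriveD ?deriveZ//; try exact: derivableZ.
    by rewrite -!derive1E.
  exact: flat_span_lin.
Qed.

Lemma bump_derivable c a b n x : 0 < c -> derivable (derive1n n (bump c a b)) x 1.
Proof.
move=> c0; suff: flat_span c a b (derive1n n (bump c a b)).
  by move=> /(flat_span_derive c0)[].
elim: n => [|n IHn]; first exact: flat_span_prod.
by rewrite derive1nS; case: (flat_span_derive c0 IHn).
Qed.

Lemma bump_support c a b x : bump c a b x != 0 -> x \in `]a, b[.
Proof.
apply: contraR; rewrite in_itv/= negb_and -!leNgt /bump.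
case/orP => xab; first by rewrite flat_exp_neg ?subr_le0 ?mul0r.
by rewrite mulrC flat_exp_neg ?subr_le0 ?mul0r.
Qed.

(** The bound is uniform in [c], so the products of f with the bumps are dominated by |f|. *)
Lemma bump_bound c a b x : 0 < c -> 0 <= bump c a b x <= 1.
Proof.
move=> c0.
have H y : 0 <= flat_exp c 0 y <= 1.
  have [y0|y0] := ltP 0 y; last by rewrite flat_exp_neg// lexx ler01.
  rewrite flat_exp_pos// mul1r expR_ge0/= -expR0 ler_expR oppr_le0.
  by rewrite divr_ge0 ?ltW.
have /andP[h1 h2] := H (x - a); have /andP[h3 h4] := H (b - x).
by rewrite /bump mulr_ge0//= mulr_ile1.
Qed.

Lemma bump_cvg a b x : x \in `]a, b[ ->
  bump n.+1%:R^-1 a b x @[n --> \oo] --> (1 : R).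
Proof.
rewrite in_itv/= => /andP[ax xb].
have H y : 0 < y -> flat_exp n.+1%:R^-1 0 y @[n --> \oo] --> (1 : R).
  move=> y0; under eq_fun do rewrite flat_exp_pos// expr0 mul1r.
  have : expR (- (n.+1%:R^-1 / y)) @[n --> \oo] --> expR (- (0 / y)).
    apply: continuous_cvg; first exact: continuous_expR.
    by apply: cvgN; apply: cvgMl; exact: cvg_harmonic.
  by rewrite mul0r oppr0 expR0.
have : bump n.+1%:R^-1 a b x @[n --> \oo] --> (1 * 1 : R).
  by apply: cvgM; apply: H; rewrite subr_gt0.
by rewrite mulr1.
Qed.

Lemma test_function_bump c a b : 0 < c -> 0 < a -> b < 1 ->
  test_function (bump c a b).
Proof.
move=> c0 a0 b1.
have sub : closure [set x | bump c a b x != 0] `<=` `[a, b].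
  have /closure_id -> : closed `[a, b] by exact: itv_closed.
  apply: closure_subset => x /bump_support/=.
  exact: subset_itv_oo_cc.
split.
- by move=> n x; exact: bump_derivable.
- exact: (subclosed_compact (@closed_closure _ _) (@segment_compact _ a b) sub).
- move=> x /sub /=; rewrite !in_itv/= => /andP[ax xb].
  by rewrite (lt_le_trans a0)// (le_lt_trans xb).
Qed.

End smooth_bump.

(** * Weak derivatives and the fundamental lemma *)

Section weak_derivative.
Context {R : realType}.
Local Notation mu := (@lebesgue_measure R).
Local Notation I01 := (`]0%R, 1%R[%classic : set R).
Implicit Types (f g df dg t : R -> R) (a b x : R).

Lemma L1loc01_integrable f (K : set R) : L1loc01 f -> compact K ->
  K `<=` I01 -> mu.-integrable K (EFin \o f).
Proof.
move=> [mf _ If] cK KD; apply/integrableP; split; last exact: If.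
by apply/measurable_EFinP; apply: measurable_funS mf.
Qed.

(** On [K], f is integrable and t is bounded by compactness; off [K] the product vanishes. Asking
    only continuity of t covers both a test function and its derivative. *)
Lemma L1loc01_mul_integrable f t (K : set R) : L1loc01 f ->
  continuous t -> compact K -> K `<=` I01 ->
  (forall x, ~ K x -> t x = 0) ->
  mu.-integrable I01 (EFin \o (fun x => f x * t x)).
Proof.
move=> Lf ct cK KD tK.
have mK : measurable K by exact: compact_measurable.
have -> : EFin \o (fun x => f x * t x) = (EFin \o (fun x => f x * t x)) \_ K.
  apply/funext => x; rewrite patchE; case: ifPn => // /negP xK.
  by rewrite /= tK ?mulr0// => Kx; apply: xK; rewrite inE.
apply: (@integrableS _ _ _ _ setT) => //.
suff : mu.-integrable K (EFin \o (fun x => f x * t x)).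
  exact: (@integrable_mkcond _ _ _ mu _ (EFin \o (fun x => f x * t x)) mK).1.
apply: (@integrableMl _ _ _ mu _ mK (EFin \o f) t) => //; first exact: L1loc01_integrable.
  by apply: measurable_funTS; exact: continuous_measurable_fun.
have ctK : compact (t @` K).
  by apply: continuous_compact => //; exact: continuous_subspaceT.
have [M [Mr Mb]] := compact_bounded ctK.
exists M; split => // y My x Kx /=.
by apply: (Mb y My); exists x.
Qed.

Lemma derivable_continuous f : (forall x, derivable f x 1) -> continuous f.
Proof.
by move=> df x; apply: differentiable_continuous; exact/derivable1_diffP.
Qed.

Lemma test_function_eq0 t x : ~ closure [set x | t x != 0] x -> t x = 0.
Proof.
by move=> tx; apply/eqP/negPn/negP => t0; apply: tx; exact: subset_closure.
Qed.

(** The complement of the support is open, so t vanishes on a whole neighbourhood of x. *)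
Lemma test_function_derive_eq0 t x : ~ closure [set x | t x != 0] x ->
  derive1 t x = 0.
Proof.
move=> tx; rewrite derive1E -[RHS](derive_cst (0 : R) x 1).
apply: near_eq_derive.
have : nbhs x (~` closure [set x | t x != 0]).
  by apply: open_nbhs_nbhs; split => //; exact: closed_openC (@closed_closure _ _).
by apply: filterS => y; exact: test_function_eq0.
Qed.

Lemma L1loc01_test_integrable f t : L1loc01 f -> test_function t ->
  mu.-integrable I01 (EFin \o (fun x => f x * t x)).
Proof.
move=> Lf tt; have [_ cK KD] := tt.
apply: (L1loc01_mul_integrable Lf _ cK KD) => [|x]; last exact: test_function_eq0.
by apply: derivable_continuous => y; case: tt => /(_ 0%N y).
Qed.

Lemma L1loc01_dtest_integrable f t : L1loc01 f -> test_function t ->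
  mu.-integrable I01 (EFin \o (fun x => f x * derive1 t x)).
Proof.
move=> Lf tt; have [_ cK KD] := tt.
apply: (L1loc01_mul_integrable Lf _ cK KD) => [|x].
  by apply: derivable_continuous => y; case: tt => /(_ 1%N y).
exact: test_function_derive_eq0.
Qed.

Lemma L1loc01_lin a b f g : L1loc01 f -> L1loc01 g ->
  L1loc01 (fun x => a * f x + b * g x).
Proof.
have Z c h : L1loc01 h -> L1loc01 (fun x => c * h x).
  move=> Lh; have [mh oD _] := Lh; split => //.
    exact: measurable_funM.
  move=> K KD cK; have mK := compact_measurable cK.
  have : mu.-integrable K (EFin \o (fun x => c * h x)).
    have -> : EFin \o (fun x => c * h x) = (fun x => c%:E * (EFin \o h) x)%E.
      by [].
    by apply: integrableZl => //; exact: L1loc01_integrable.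
  by case/integrableP.
by move=> Lf Lg; apply: locally_integrableD; exact: Z.
Qed.

Lemma Rintegral_lin (D : set R) a b f g : measurable D ->
  mu.-integrable D (EFin \o f) -> mu.-integrable D (EFin \o g) ->
  \int[mu]_(x in D) (a * f x + b * g x) =
  a * \int[mu]_(x in D) f x + b * \int[mu]_(x in D) g x.
Proof.
move=> mD If Ig; rewrite RintegralD//; last 2 first.
- have -> : EFin \o (fun x => a * f x) = (fun x => a%:E * (EFin \o f) x)%E by [].
  exact: integrableZl.
- have -> : EFin \o (fun x => b * g x) = (fun x => b%:E * (EFin \o g) x)%E by [].
  exact: integrableZl.
by rewrite !RintegralZl.
Qed.

Lemma is_weak_derivative_lin a b f df g dg :
  is_weak_derivative f df -> is_weak_derivative g dg ->
  is_weak_derivative (fun x => a * f x + b * g x)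
    (fun x => a * df x + b * dg x).
Proof.
move=> [Lf Ldf Hf] [Lg Ldg Hg]; split; [exact: L1loc01_lin..|].
move=> t tt.
under eq_Rintegral do rewrite mulrDl -!mulrA.
under [in RHS]eq_Rintegral do rewrite mulrDl -!mulrA.
rewrite !Rintegral_lin//; try exact: measurable_itv;
  try exact: L1loc01_test_integrable; try exact: L1loc01_dtest_integrable.
by rewrite Hf// Hg// !mulrN opprD.
Qed.

(* [bump n.+1%:R^-1 a b] tends boundedly to the indicator of ]a, b[. *)
Lemma test_null_itv f a b : L1loc01 f ->
  (forall t, test_function t -> \int[mu]_(x in I01) (f x * t x) = 0) ->
  0 < a -> b < 1 -> (\int[mu]_(x in (`]a, b[%classic : set R)) (f x)%:E = 0)%E.
Proof.
move=> Lf Hf a0 b1.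
have abD : `[a, b] `<=` I01.
  move=> x /=; rewrite !in_itv/= => /andP[ax xb].
  by rewrite (lt_le_trans a0)// (le_lt_trans xb).
have ooD : `]a, b[ `<=` I01.
  by apply: subset_trans abD; exact: subset_itv_oo_cc.
have cab : compact `[a, b] by exact: segment_compact.
have mD : measurable (I01 : set (measurableTypeR R)) by exact: measurable_itv.
pose c n : R := n.+1%:R^-1.
have c0 n : 0 < c n by rewrite invr_gt0.
have tb n := test_function_bump (c0 n) a0 b1.
have Ifb n := L1loc01_test_integrable Lf (tb n).
have Iab := L1loc01_integrable Lf cab abD.
(* [Rintegral] applies [fine], which sends infinities to 0, so integrability is needed to recover
   the extended equation. *)
have lim0 n : (\int[mu]_(x in I01) (f x * bump (c n) a b x)%:E = 0)%E.
  have := Hf _ (tb n); rewrite /Rintegral => H.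
  have F := integrable_fin_num mD (Ifb n).
  rewrite -[LHS]fineK//.
  by rewrite H.
have Ir (K : set R) : measurable (K : set (measurableTypeR R)) ->
    K `<=` `[a, b] -> mu.-integrable setT ((EFin \o f) \_ K).
  move=> mK Kab; apply: (@integrable_mkcond _ _ _ mu _ (EFin \o f) mK).1.
  exact: integrableS Iab.
have Ioo : mu.-integrable setT ((EFin \o f) \_ `]a, b[).
  by apply: Ir; [exact: measurable_itv|exact: subset_itv_oo_cc].
have Icc : mu.-integrable setT ((EFin \o f) \_ `[a, b]).
  by apply: Ir; first exact: measurable_itv.
(* The dominating function is |f| cut off to [a, b], integrable because [a, b] is compact in ]0,
   1[. *)
have [] := @dominated_convergence _ _ _ mu I01 mD
    (fun n => EFin \o (fun x => f x * bump (c n) a b x))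
    ((EFin \o f) \_ `]a, b[) (abse \o ((EFin \o f) \_ `[a, b])).
- by move=> n; exact: measurable_int (Ifb n).
- by apply: measurable_funTS; exact: measurable_int Ioo.
- apply: aeW => x Dx.
  rewrite patchE; case: ifPn => [|/negP] xab.
    have : f x * bump (c n) a b x @[n --> \oo] --> f x * 1.
      by apply: cvgMr; apply: bump_cvg; rewrite inE in xab.
    by rewrite mulr1 => ?; apply: cvg_EFin => //; exact: nearW.
  rewrite (_ : (fun n => _) = cst 0%E); first exact: cvg_cst.
  apply/funext => n /=; have [->|/bump_support xI] := eqVneq (bump (c n) a b x) 0.
    by rewrite mulr0.
  by case: xab; rewrite inE.
- by apply: integrable_abse; apply: integrableS Icc.
- apply: aeW => x n Dx /=.
  rewrite patchE; case: ifPn => [|/negP] xab.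
    have /andP[b0 b1'] := bump_bound a b x (c0 n).
    by rewrite lee_fin normrM ler_piMr// ger0_norm.
  have [->|/bump_support xI] := eqVneq (bump (c n) a b x) 0.
    by rewrite mulr0 normr0 abse0 lexx.
  by case: xab; rewrite inE; exact: subset_itv_oo_cc xI.
move=> _ _.
under eq_fun do rewrite lim0.
move=> /cvg_lim; rewrite lim_cst// => /(_ (@ereal_hausdorff _)) ->.
by rewrite -integral_mkcondr setIidr.
Qed.

(** By [test_null_itv] the primitive of f based at a is 0 around every point of ]a, b[, and Lebesgue
    differentiation gives f = 0 a.e. there. *)
Lemma fundamental_lemma_of_calculus_of_variations f : L1loc01 f ->
  (forall t, test_function t -> \int[mu]_(x in I01) (f x * t x) = 0) ->
  \forall x \ae mu, I01 x -> f x = 0.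
Proof.
move=> Lf Hf.
have H a b : 0 < a -> b < 1 -> \forall x \ae mu, x \in `]a, b[ -> f x = 0.
  have [ab|ba] := ltP a b; last first.
    move=> a0 b1; apply: aeW => x; rewrite in_itv/= => /andP[ax xb].
    by have := lt_trans ax xb; rewrite ltNge ba.
  move=> a0 b1.
  have abD : `[a, b] `<=` I01.
    move=> x /=; rewrite !in_itv/= => /andP[ax xb].
    by rewrite (lt_le_trans a0)// (le_lt_trans xb).
  have Iab := L1loc01_integrable Lf (@segment_compact _ a b) abD.
  have mab : measurable (`[a, b]%classic : set (measurableTypeR R)).
    exact: measurable_itv.
  have Ir := (@integrable_mkcond _ _ _ mu _ (EFin \o f) mab).1 Iab.
  (* f need not be integrable up to 0 and 1; its cutoff to [a, b] is integrable on the whole line,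
     as [FTC1] is applied to it. *)
  have Irf : mu.-integrable setT (EFin \o (f \_ `[a, b])).
    by move: Ir; rewrite restrict_EFin.
  have /= := @FTC1 R (f \_ `[a, b]) (BLeft a).
  have h1 y : mu.-integrable [set` Interval (BLeft a) (BRight y)]
      (EFin \o f \_ `[a, b]).
    by apply: integrableS Irf.
  move=> /(_ h1 (open_integrable_locally openT Irf)).
  apply: (@filterS _ _ (ae_filter_ringOfSetsType mu)) => x Fx xab.
  have := xab; rewrite in_itv/= => /andP[ax xb].
  have ax' : (a%:E < x%:E)%E by rewrite lte_fin.
  have [_] := Fx ax'.
  rewrite patchE ifT; last by rewrite inE; exact: subset_itv_oo_cc xab.
  move=> <-; rewrite derive1E -[RHS](derive_cst (0 : R) x 1).
  apply: near_eq_derive.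
  have : \forall y \near x, a < y /\ y < b.
    by near=> y; split; near: y; [exact: lt_nbhsr|exact: lt_nbhsl].
  apply: filterS => y [ay yb].
  have yb1 := lt_trans yb b1.
  rewrite (eq_Rintegral mu (g := f)); last first.
    move=> z; rewrite inE/= in_itv/= => /andP[az zy].
    by rewrite patchE ifT// inE/= in_itv/= az (le_trans zy)// ltW.
  have ycc : `[a, y] `<=` I01.
    move=> z /=; rewrite !in_itv/= => /andP[az zy].
    by rewrite (lt_le_trans a0)// (le_lt_trans zy).
  have Icc := L1loc01_integrable Lf (@segment_compact _ a y) ycc.
  (* Points are null, so both ends are opened to match [test_null_itv]. *)
  rewrite -Rintegral_itv_obnd_cbnd; last first.
    by apply: integrableS Icc => //; exact: subset_itv_oc_cc.
  rewrite -Rintegral_itv_bndo_bndc; last first.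
    by apply: integrableS Icc => //; exact: subset_itv_oo_cc.
  by rewrite /Rintegral (test_null_itv Lf Hf a0 yb1).
(* Countably many intervals exhaust ]0, 1[, and a countable union of null sets is null. *)
have : \forall x \ae mu, forall n : nat,
    x \in `](n.+1%:R^-1 : R), 1 - n.+1%:R^-1[ -> f x = 0.
  apply: ae_foralln => n; apply: H; first by rewrite invr_gt0.
  by rewrite ltrBlDr ltrDl invr_gt0.
apply: (@filterS _ _ (ae_filter_ringOfSetsType mu)) => x Hx /=.
rewrite in_itv/= => /andP[x0 x1].
have := near_infty_natSinv_lt (PosNum x0) => -[N _ HN].
have x10 : 0 < 1 - x by rewrite subr_gt0.
have := near_infty_natSinv_lt (PosNum x10) => -[M _ HM].
apply: (Hx (maxn N M)); rewrite in_itv/= HN/= ?leq_maxl//.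
rewrite ltrBrDl -ltrBrDr; apply: HM => /=; exact: leq_maxr.
Unshelve. all: by end_near. Qed.

Lemma weak_derivative_unique f df dg :
  is_weak_derivative f df -> is_weak_derivative f dg ->
  df = dg %[ae mu in I01].
Proof.
move=> [Lf Ldf Hf] [_ Ldg Hg].
have L := L1loc01_lin 1 (-1) Ldf Ldg.
have := fundamental_lemma_of_calculus_of_variations L.
have mD : measurable (I01 : set (measurableTypeR R)) by exact: measurable_itv.
have H t : test_function t ->
    \int[mu]_(x in I01) ((1 * df x + -1 * dg x) * t x) = 0.
  move=> tt; under eq_Rintegral do rewrite mulrDl -!mulrA.
  rewrite Rintegral_lin//; try exact: L1loc01_test_integrable.
  by have := Hf t tt; rewrite Hg// => /oppr_inj ->; rewrite mul1r mulN1r subrr.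
move=> /(_ H); apply: (@filterS _ _ (ae_filter_ringOfSetsType mu)) => x /[apply] /eqP.
by rewrite mul1r mulN1r subr_eq0 => /eqP.
Qed.

Lemma is_weak_derivative_wderiv f : W11loc01 f -> is_weak_derivative f (wderiv f).
Proof. by move=> wf; apply: (xgetPex (cst 0)). Qed.

Lemma wderiv_ae_eq f df : is_weak_derivative f df ->
  wderiv f = df %[ae mu in I01].
Proof.
move=> fdf; apply: weak_derivative_unique (fdf).
by apply: is_weak_derivative_wderiv; exists df.
Qed.

(** The defining identity sees f only through integrals, so the weak derivative chosen for g is also
    one for f. This will carry equality of velocities over to the [beta] components. *)
Lemma ae_eq_wderiv f g : W11loc01 f -> W11loc01 g ->
  f = g %[ae mu in I01] -> wderiv f = wderiv g %[ae mu in I01].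
Proof.
move=> wf wg fg; apply: wderiv_ae_eq.
have [Lf _ _] := is_weak_derivative_wderiv wf.
have [Lg Ldg Hg] := is_weak_derivative_wderiv wg.
split => // t tt; rewrite -Hg//; congr fine.
have mD : measurable (I01 : set (measurableTypeR R)) by exact: measurable_itv.
apply: ae_eq_integral => //.
- exact: measurable_int (L1loc01_dtest_integrable Lf tt).
- exact: measurable_int (L1loc01_dtest_integrable Lg tt).
- by move: fg; apply: (@filterS _ _ (ae_filter_ringOfSetsType mu)) => x /[apply] ->.
Qed.

End weak_derivative.

(** * Midpoints in the function spaces *)

Section midpoint.
Context {R : realType}.
Local Notation mu := (@lebesgue_measure R).
Local Notation I01 := (`]0%R, 1%R[%classic : set R).
Implicit Types (f g : R -> R) (s x y : R).

(** Written so that [L1loc01_lin] and [is_weak_derivative_lin] apply with both coefficients equal to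
    2^-1. *)
Definition mid f g x : R := 2^-1 * f x + 2^-1 * g x.

Lemma C2_midpoint_convex (D : set R) f : is_interval D -> C2_on D f ->
  (forall x, D x -> 0 <= derive1n 2 f x) ->
  forall x y, D x -> D y ->
    f (2^-1 * x + 2^-1 * y) <= 2^-1 * f x + 2^-1 * f y.
Proof.
move=> iD C2f f2 x y Dx Dy.
wlog xy : x y Dx Dy / x <= y.
  move=> H; have [xy|/ltW yx] := leP x y; first exact: H.
  by rewrite addrC [leRHS]addrC; exact: H.
have Dz z : x <= z <= y -> D z by exact: iD.
have dE g : 'D_1 g = derive1 g by apply/funext => z; rewrite derive1E.
have ct z : x <= z <= y -> f w @[w --> z] --> f z.
  move=> /Dz /C2f[dfz _ _].
  by apply: differentiable_continuous; exact/derivable1_diffP.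
(* [second_derivative_convex] uses weights t and 1 - t, taken here at t = 1/2. *)
have e : 1 - 2^-1 = 2^-1 :> R by lra.
suff : f (2^-1 * x + (1 - 2^-1) * y) <= 2^-1 * f x + (1 - 2^-1) * f y.
  by rewrite e.
have h0 : 0 <= 2^-1 :> R by lra.
have h1 : 2^-1 <= 1 :> R by lra.
apply: (@second_derivative_convex R f x y _ _ _ _ _ (Itv01 h0 h1) xy).
- move=> z /andP[xz zy]; rewrite (dE f) -derive1E; apply: (f2 z).
  by apply: Dz; rewrite !ltW.
- by apply: cvg_at_left_filter; apply: ct; rewrite xy lexx.
- by apply: cvg_at_right_filter; apply: ct; rewrite xy lexx.
- move=> z; rewrite in_itv/= => /andP[xz zy].
  have /C2f[df _ _] : D z by apply: Dz; rewrite !ltW.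
  exact: df.
- move=> z; rewrite in_itv/= => /andP[xz zy]; rewrite (dE f).
  have /C2f[_ ddf _] : D z by apply: Dz; rewrite !ltW.
  exact: ddf.
Qed.

Lemma C2_measurable (D : set R) f : open D -> C2_on D f -> measurable_fun D f.
Proof.
move=> oD C2f; apply: open_continuous_measurable_fun => // x.
rewrite inE => /C2f[dfx _ _].
by apply: differentiable_continuous; exact/derivable1_diffP.
Qed.

Lemma Lp01_mid s f g : 1 <= s -> Lp01 s f -> Lp01 s g -> Lp01 s (mid f g).
Proof.
move=> s1 Lf Lg; rewrite /Lp01.
have s1' : (1 <= s%:E)%E by rewrite lee_fin.
have [S0 Slin] := @Lfun_submod_closed _ _ _ mu _ s1'.
have -> : mid f g \_ `]0, 1[ =
    2^-1 *: (f \_ `]0, 1[) + (2^-1 *: (g \_ `]0, 1[) + 0).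
  apply/funext => x; rewrite addr0 !fctE /= !patchE.
  by case: ifPn => // _; rewrite !scaler0 addr0.
by apply: (Slin) => //; exact: (Slin).
Qed.

(** The integral of |f|^s depends only on the a.e. class; measurability of g is assumed separately
    because a.e. equality need not preserve Borel measurability. *)
Lemma Lp01_ae s f g : Lp01 s f -> measurable_fun I01 g ->
  f = g %[ae mu in I01] -> Lp01 s g.
Proof.
rewrite /Lp01 => /andP[]; rewrite !inE/= => mf ff mg fg.
have mD : measurable (I01 : set (measurableTypeR R)) by exact: measurable_itv.
have mg' : measurable_fun setT (g \_ `]0, 1[) by apply/(measurable_restrictT _ mD).
apply/andP; split; rewrite inE//=.
have E : (\int[mu]_x `|((f \_ I01) x)%:E| `^ s =
    \int[mu]_x `|((g \_ I01) x)%:E| `^ s)%E.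
  apply: ae_eq_integral => //.
  - apply: (measurableT_comp (measurable_poweR _)).
    by apply: measurableT_comp => //; exact/measurable_EFinP.
  - apply: (measurableT_comp (measurable_poweR _)).
    by apply: measurableT_comp => //; exact/measurable_EFinP.
  - move: fg; apply: (@filterS _ _ (ae_filter_ringOfSetsType mu)) => x fg _ /=.
    by rewrite !patchE; case: ifPn => // /[1!inE] /fg ->.
by move: ff; rewrite /finite_norm unlock E.
Qed.

Lemma W11loc01_mid f g : W11loc01 f -> W11loc01 g ->
  W11loc01 (mid f g) /\
  wderiv (mid f g) = mid (wderiv f) (wderiv g) %[ae mu in I01].
Proof.
move=> /is_weak_derivative_wderiv wf /is_weak_derivative_wderiv wg.
have w := is_weak_derivative_lin 2^-1 2^-1 wf wg.
by split; [exists (mid (wderiv f) (wderiv g))|exact: wderiv_ae_eq].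
Qed.

Lemma W11loc01_measurable f : W11loc01 f ->
  measurable_fun I01 f /\ measurable_fun I01 (wderiv f).
Proof. by move=> /is_weak_derivative_wderiv[[mf _ _] [mdf _ _] _]. Qed.

(** [wderiv (mid f g)] is a chosen representative, so it is the midpoint of the derivatives only
    a.e., whence [Lp01_ae]. The weight [k] stands for the powers of r in the spaces, and for 1 in
    [spaceX1]. *)
Lemma Lp01_wderiv_mid s (k : R -> R) f g : 1 <= s ->
  measurable_fun I01 k -> W11loc01 f -> W11loc01 g ->
  Lp01 s (fun x => wderiv f x * k x) -> Lp01 s (fun x => wderiv g x * k x) ->
  Lp01 s (fun x => wderiv (mid f g) x * k x).
Proof.
move=> s1 mk wf wg Lf Lg; have [wm dm] := W11loc01_mid wf wg.
apply: (Lp01_ae (Lp01_mid s1 Lf Lg)).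
  by apply: measurable_funM => //; exact: (W11loc01_measurable wm).2.
move: dm; apply: (@filterS _ _ (ae_filter_ringOfSetsType mu)) => x dm xI.
by rewrite dm// /mid; ring.
Qed.

Lemma spaceX1_mid s f g : 1 <= s ->
  spaceX1 s f -> spaceX1 s g -> spaceX1 s (mid f g).
Proof.
move=> s1 [[wf Lf Ldf] Lpf] [[wg Lg Ldg] Lpg]; split; first split.
- by have [] := W11loc01_mid wf wg.
- exact: Lp01_mid.
- have E h : (fun x => wderiv h x * cst (1 : R) x) = wderiv h.
    by apply/funext => x; rewrite mulr1.
  rewrite -E; apply: Lp01_wderiv_mid => //; by rewrite E.
- have -> : (fun r => mid f g r / r) = mid (fun r => f r / r) (fun r => g r / r).
    by apply/funext => r; rewrite /mid; ring.
  exact: Lp01_mid.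
Qed.

Lemma spaceX2_mid s f g : 1 <= s ->
  spaceX2 s f -> spaceX2 s g -> spaceX2 s (mid f g).
Proof.
move=> s1 [Lf Lpf] [Lg Lpg]; split; first exact: L1loc01_lin.
have -> : (fun r => mid f g r * r `^ (2 / 3)) =
    mid (fun r => f r * r `^ (2 / 3)) (fun r => g r * r `^ (2 / 3)).
  by apply/funext => r; rewrite /mid; ring.
by apply: Lp01_mid => //; lra.
Qed.

Lemma measurable_powR01 s : measurable_fun I01 (@powR R ^~ s).
Proof. by apply: measurable_funTS; exact: measurable_powR. Qed.

Lemma spaceX3_mid s f g : 1 <= s ->
  spaceX3 s f -> spaceX3 s g -> spaceX3 s (mid f g).
Proof.
move=> s1 [wf Lf Ldf] [wg Lg Ldg]; split.
- by have [] := W11loc01_mid wf wg.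
- have -> : (fun r => mid f g r / r `^ (2 / 3)) =
    mid (fun r => f r / r `^ (2 / 3)) (fun r => g r / r `^ (2 / 3)).
    by apply/funext => r; rewrite /mid; ring.
  exact: Lp01_mid.
- by apply: Lp01_wderiv_mid => //; exact: measurable_powR01.
Qed.

Lemma spaceY_mid s f g : 1 <= s ->
  spaceY s f -> spaceY s g -> spaceY s (mid f g).
Proof.
move=> s1 [wf Lf Ldf] [wg Lg Ldg]; split.
- by have [] := W11loc01_mid wf wg.
- by apply: Lp01_mid => //; lra.
- by apply: Lp01_wderiv_mid => //; [lra|exact: measurable_powR01].
Qed.

Lemma boundary_value_mid f g x l m : boundary_value f x l ->
  boundary_value g x m -> boundary_value (mid f g) x (2^-1 * l + 2^-1 * m).
Proof.
move=> [fc [cf fE fx]] [gc [cg gE gx]]; exists (mid fc gc); split.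
- by move=> z; apply: cvgD; apply: cvgMr; [exact: cf|exact: cg].
- move: fE gE; apply: (@filterS2 _ _ (ae_filter_ringOfSetsType mu)).
  by move=> z fz gz zI; rewrite /mid fz// gz.
- by rewrite /mid fx gx.
Qed.

Definition mid_fields (u w : fields R) : fields R :=
  Fields (mid (alpha u) (alpha w)) (mid (beta u) (beta w))
    (mid (gamma u) (gamma w)) (mid (vel u) (vel w)).

End midpoint.

(** * Convexity of the functional and uniqueness of the velocity *)

Section uniqueness.
Context {R : realType}.
Local Notation mu := (@lebesgue_measure R).
Local Notation I01 := (`]0%R, 1%R[%classic : set R).
Context (p q lambda tau : R) (phi psi g h : R -> R) (u0 : fields R)
  (p1 : 1 < p) (q1 : 1 < q) (const : constitutive p q phi psi g h)
  (u0X : spaceX p q u0).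
Implicit Types (u w : fields R) (x y : R).

Local Notation adm := (admissible p q lambda tau phi psi g h u0).
Local Notation fnl := (functional phi psi g h u0).

(** Kept convertible to the integrand of [functional], so that facts about it apply to the
    functional directly. *)
Definition density u r : R := 1 / 2 * (vel u r - vel u0 r) ^+ 2
  + energy phi psi g h (alpha u) (beta u) (gamma u) r.

Lemma density_ge0 u r : 0 <= density u r.
Proof.
have [phi0 psi0 g0 h0] := A2_ge0 const.
have H0 : 0 <= (h \_ `]0, +oo[) (wderiv (alpha u) r).
  rewrite patchE; case: ifPn => //; rewrite inE/= in_itv/= andbT.
  exact: h0.
by rewrite /density /energy !addr_ge0// mulr_ge0// sqr_ge0.
Qed.

Lemma measurable_inv01 : measurable_fun I01 (@GRing.inv R).
Proof.
apply: open_continuous_measurable_fun; first exact: interval_open.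
by move=> x; rewrite inE/= in_itv/= => /andP[x0 _]; apply: inv_continuous; rewrite gt_eqF.
Qed.

Lemma measurable_density u : spaceX p q u -> measurable_fun I01 (density u).
Proof.
move=> [[[wa _ _] _] [Lb _] [wc _ _] [wv _ _]].
have [C2phi C2psi C2g C2h] := A2_smooth const.
have mC (f : R -> R) : C2_on setT f -> measurable_fun setT f.
  by apply: C2_measurable; exact: openT.
have [ma mda] := W11loc01_measurable wa.
have [mc mdc] := W11loc01_measurable wc.
have [mv _] := W11loc01_measurable wv.
have [mv0 _] : measurable_fun I01 (vel u0) /\ measurable_fun I01 (wderiv (vel u0)).
  by case: u0X => _ _ _ [wv0 _ _]; exact: W11loc01_measurable.
have [mb _ _] := Lb.
have mh : measurable_fun setT (h \_ `]0, +oo[).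
  apply/(measurable_restrictT _ (measurable_itv _)).
  by apply: C2_measurable => //; exact: interval_open.
have mp (s : R) := measurable_powR01 s.
have mpV (s : R) : measurable_fun I01 (fun r : R => (r `^ s)^-1).
  rewrite (_ : (fun r => _) = (@powR R ^~ (- s))); first exact: mp.
  by apply/funext => r; rewrite powRN.
have m1 : measurable_fun I01 (fun r => 1 / 2 * (vel u r - vel u0 r) ^+ 2).
  by apply: measurable_funM => //; apply: measurable_funX; exact: measurable_funB.
have m2 : measurable_fun I01 (fun r => phi (beta u r * r `^ (2 / 3))).
  exact: (measurableT_comp (mC _ C2phi) (measurable_funM mb (mp (2 / 3)))).
have m3 : measurable_fun I01 (fun r => 2 * psi (alpha u r / r)).
  apply: measurable_funM => //.
  exact: (measurableT_comp (mC _ C2psi) (measurable_funM ma measurable_inv01)).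
have m4 : measurable_fun I01 (fun r => g (gamma u r / r `^ (2 / 3))).
  exact: (measurableT_comp (mC _ C2g) (measurable_funM mc (mpV (2 / 3)))).
have m5 : measurable_fun I01
    (fun r => 2 * g (3 / 2 * wderiv (gamma u) r * r `^ (1 / 3))).
  apply: measurable_funM => //; apply: (measurableT_comp (mC _ C2g)
    (measurable_funM (measurable_funM _ mdc) (mp (1 / 3)))).
  exact: measurable_cst.
have m6 := measurableT_comp mh mda.
exact: (measurable_funD m1 (measurable_funD (measurable_funD
  (measurable_funD (measurable_funD m2 m3) m4) m5) m6)).
Qed.

(** The factor 1/8 comes from the parallelogram identity 1/2 ((a + b)/2)^2 = 1/4 a^2 + 1/4 b^2 - 1/8
    (a - b)^2 at a = v_u - v_0, b = v_w - v_0; v_0 cancels in a - b. *)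
Definition vel_gap u w r : R := 8^-1 * (vel u r - vel w r) ^+ 2.

Lemma vel_gap_ge0 u w r : 0 <= vel_gap u w r.
Proof. by rewrite mulr_ge0 ?invr_ge0 ?sqr_ge0. Qed.

Lemma measurable_vel_gap u w : spaceX p q u -> spaceX p q w ->
  measurable_fun I01 (EFin \o vel_gap u w).
Proof.
have mv v : spaceX p q v -> measurable_fun I01 (vel v).
  by move=> [_ _ _ [wv _ _]]; have [] := W11loc01_measurable wv.
move=> /mv mvu /mv mvw; apply/measurable_EFinP.
apply: measurable_funM => //; apply: measurable_funX.
exact: measurable_funB.
Qed.

Lemma spaceX_mid u w : spaceX p q u -> spaceX p q w ->
  spaceX p q (mid_fields u w).
Proof.
have [p1' q1'] := (ltW p1, ltW q1).
move=> [au bu cu vu] [aw bw cw vw]; split => /=.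
- exact: spaceX1_mid.
- exact: spaceX2_mid.
- exact: spaceX3_mid.
- exact: spaceY_mid.
Qed.

(** The arguments of phi, psi, g and h are linear in the fields, so midpoint convexity applies term
    by term. Linearity and positivity of the weak derivatives hold only a.e. *)
Lemma density_mid_convex u w : spaceX p q u -> spaceX p q w ->
  ae_pos (wderiv (alpha u)) -> ae_pos (wderiv (alpha w)) ->
  \forall r \ae mu, I01 r ->
    density (mid_fields u w) r + vel_gap u w r
      <= 2^-1 * density u r + 2^-1 * density w r.
Proof.
move=> [[[wau _ _] _] _ [wcu _ _] _] [[[waw _ _] _] _ [wcw _ _] _] pu pw.
have [_ da] := W11loc01_mid wau waw.
have [_ dc] := W11loc01_mid wcu wcw.
have [C2phi C2psi C2g C2h] := A2_smooth const.
have [phi2 psi2 g2 h2] := A2_convex const.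
have cvx (f : R -> R) : C2_on setT f -> (forall x, 0 <= derive1n 2 f x) ->
    forall x y, f (2^-1 * x + 2^-1 * y) <= 2^-1 * f x + 2^-1 * f y.
  move=> C2f f2 x y.
  exact: (@C2_midpoint_convex _ setT).
have cvxh x y : 0 < x -> 0 < y ->
    h (2^-1 * x + 2^-1 * y) <= 2^-1 * h x + 2^-1 * h y.
  move=> x0 y0; apply: (C2_midpoint_convex _ C2h).
  - exact: interval_is_interval.
  - by move=> z; rewrite /= in_itv/= andbT => /h2/ltW.
  - by rewrite /= in_itv/= x0.
  - by rewrite /= in_itv/= y0.
have aeF := ae_filter_ringOfSetsType mu.
apply: filterS2 (filterI pu pw) (filterI da dc) => r [pur pwr] [dar dcr] rI.
have {pur}H1 := pur rI; have {pwr}H2 := pwr rI.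
(* Every argument is displayed as a midpoint; positivity of both derivatives removes the extension
   of h by 0. *)
have -> : density (mid_fields u w) r = 1 / 2 *
    (2^-1 * vel u r + 2^-1 * vel w r - vel u0 r) ^+ 2 +
  (phi (2^-1 * (beta u r * r `^ (2 / 3)) + 2^-1 * (beta w r * r `^ (2 / 3))) +
   2 * psi (2^-1 * (alpha u r / r) + 2^-1 * (alpha w r / r)) +
   g (2^-1 * (gamma u r / r `^ (2 / 3)) + 2^-1 * (gamma w r / r `^ (2 / 3))) +
   2 * g (2^-1 * (3 / 2 * wderiv (gamma u) r * r `^ (1 / 3)) +
          2^-1 * (3 / 2 * wderiv (gamma w) r * r `^ (1 / 3))) +
   h (2^-1 * wderiv (alpha u) r + 2^-1 * wderiv (alpha w) r)).
  rewrite /density /energy /= dar// dcr// /mid patchE ifT; last first.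
    by rewrite inE/= in_itv/= andbT addr_gt0// mulr_gt0// invr_gt0.
  congr (_ + (phi _ + 2 * psi _ + g _ + 2 * g _ + _)); ring.
rewrite /density /energy /vel_gap.
have := cvx _ C2phi phi2 (beta u r * r `^ (2 / 3)) (beta w r * r `^ (2 / 3)).
have := cvx _ C2psi psi2 (alpha u r / r) (alpha w r / r).
have := cvx _ C2g g2 (gamma u r / r `^ (2 / 3)) (gamma w r / r `^ (2 / 3)).
have := cvx _ C2g g2 (3 / 2 * wderiv (gamma u) r * r `^ (1 / 3))
  (3 / 2 * wderiv (gamma w) r * r `^ (1 / 3)).
have := cvxh _ _ H1 H2.
rewrite !patchE !ifT; try by rewrite inE/= in_itv/= ?H1 ?H2.
(* The five convexity inequalities, weighted as in the energy, are added to the parallelogram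
   identity. *)
lra.
Qed.

(** All integrands are nonnegative, so the pointwise inequality integrates in the extended reals.
    Finiteness at the midpoint is not presupposed: it will be deduced from this bound in
    [admissible_mid]. *)
Lemma functional_mid u w : adm u -> adm w ->
  (fnl (mid_fields u w)
    + \int[mu]_(r in I01) (vel_gap u w r)%:E
   <= 2^-1%:E * fnl u + 2^-1%:E * fnl w)%E.
Proof.
move=> [uX _ pu _ _] [wX _ pw _ _].
have mX := spaceX_mid uX wX.
have mD : measurable (I01 : set (measurableTypeR R)) by exact: measurable_itv.
have md v : spaceX p q v -> measurable_fun I01 (EFin \o density v).
  by move=> vX; apply/measurable_EFinP; exact: measurable_density.
have d0 v r : (0 <= (density v r)%:E)%E by rewrite lee_fin density_ge0.
have msq := measurable_vel_gap uX wX.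
have sq0 r : (0 <= (vel_gap u w r)%:E)%E by rewrite lee_fin vel_gap_ge0.
have half0 : (0 <= (2^-1 : R)%:E)%E by rewrite lee_fin.
have hZ v : spaceX p q v -> (2^-1%:E * fnl v =
    \int[mu]_(r in I01) (2^-1%:E * (density v r)%:E))%E.
  by move=> vX; rewrite ge0_integralZl//; exact: md.
have hD : (2^-1%:E * fnl u + 2^-1%:E * fnl w =
    \int[mu]_(r in I01) (2^-1%:E * (density u r)%:E) +
    \int[mu]_(r in I01) (2^-1%:E * (density w r)%:E))%E.
  by congr (_ + _)%E; exact: hZ.
rewrite [leRHS]hD /functional.
rewrite -(@ge0_integralD _ _ _ mu _ mD _ _ (fun r _ => d0 (mid_fields u w) r)
  (md _ mX) (fun r _ => sq0 r) msq).
have mh v : spaceX p q v ->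
    measurable_fun I01 (fun r => 2^-1%:E * (density v r)%:E)%E.
  by move=> vX; apply: emeasurable_funM => //; exact: md.
have h0 v r : I01 r -> (0 <= 2^-1%:E * (density v r)%:E)%E.
  by rewrite mule_ge0.
rewrite -(@ge0_integralD _ _ _ mu _ mD _ _ (h0 u) (mh _ uX) (h0 w) (mh _ wX)).
apply: (@ae_ge0_le_integral _ _ _ mu _ mD).
- by move=> r _; apply: adde_ge0; [exact: d0|exact: sq0].
- by apply: emeasurable_funD => //; exact: md.
- by move=> r rI; apply: adde_ge0; exact: h0.
- by apply: emeasurable_funD; exact: mh.
have aeF := ae_filter_ringOfSetsType mu.
apply: filterS (density_mid_convex uX wX pu pw) => r /[apply].
by rewrite -!EFinM -!EFinD lee_fin.
Qed.

Lemma admissible_mid u w : adm u -> adm w -> adm (mid_fields u w).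
Proof.
move=> au aw; have Fm := functional_mid au aw.
have aeF := ae_filter_ringOfSetsType mu.
have {au}[uX [[a au0 a0] au1] pu Fu [cu1 cu2 cu3]] := au.
have {aw}[wX [[b aw0 b0] aw1] pw Fw [cw1 cw2 cw3]] := aw.
have [[[wau _ _] _] _ _ [wvu _ _]] := uX.
have [[[waw _ _] _] _ _ [wvw _ _]] := wX.
split.
- exact: spaceX_mid.
- split; first exists (2^-1 * a + 2^-1 * b).
  + exact: boundary_value_mid.
  + by rewrite addr_ge0// mulr_ge0.
  + have -> : lambda = 2^-1 * lambda + 2^-1 * lambda by lra.
    exact: boundary_value_mid.
- have [_ da] := W11loc01_mid wau waw.
  apply: filterS2 (filterI pu pw) da => r [pur pwr] dar rI.
  by rewrite dar// addr_gt0// mulr_gt0// ?pur ?pwr.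
- apply: (@le_lt_trans _ _ (2^-1%:E * fnl u + 2^-1%:E * fnl w)%E).
    apply: le_trans Fm; rewrite leeDl// integral_ge0// => r _.
    by rewrite lee_fin vel_gap_ge0.
  have half_lty (x : \bar R) : (x < +oo -> 2^-1%:E * x < +oo)%E.
    by move=> xoo; rewrite lte_mul_pinfty// lee_fin.
  exact: lte_add_pinfty (half_lty _ Fu) (half_lty _ Fw).
(* The coefficients involve only the fixed data, so the constraints are affine in the unknowns; the
   first also uses the a.e. linearity of [wderiv]. *)
split.
- have [_ dv] := W11loc01_mid wvu wvw.
  apply: filterS2 (filterI cu1 cw1) dv => r [cu cw] dvr rI.
  by have {}cu := cu rI; have {}cw := cw rI; rewrite dvr//= /mid; lra.
- apply: filterS2 cu2 cw2 => r cu cw rI.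
  by have {}cu := cu rI; have {}cw := cw rI; rewrite /= /mid; lra.
- apply: filterS2 cu3 cw3 => r cu cw rI.
  by have {}cu := cu rI; have {}cw := cw rI; rewrite /= /mid; lra.
Qed.

(** With a = b the inequalities give a + d <= m + d <= a, and the finite a cancels. *)
Lemma gap_eq0 (a b m d : \bar R) : a = b -> a \is a fin_num -> (0 <= d)%E ->
  (m + d <= 2^-1%:E * a + 2^-1%:E * b)%E -> (a <= m)%E -> d = 0%E.
Proof.
move=> <- afin d0; rewrite -muleDl ?fin_num_adde_defl//.
rewrite -EFinD (_ : 2^-1 + 2^-1 = 1); last by lra.
rewrite mul1e => mda am; apply/eqP; rewrite eq_le d0 andbT -(leeD2lE _ _ afin) adde0.
by apply: le_trans mda; exact: leeD2r.
Qed.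

(** The midpoint cannot go below the common minimum, so the integral of the nonnegative [vel_gap] is
    0 and [vel_gap] vanishes a.e. *)
Lemma minimizer_vel_unique u w :
  minimizer p q lambda tau phi psi g h u0 u ->
  minimizer p q lambda tau phi psi g h u0 w ->
  vel u = vel w %[ae mu in I01].
Proof.
move=> [au min_u] [aw min_w].
have aeF := ae_filter_ringOfSetsType mu.
have mD : measurable (I01 : set (measurableTypeR R)) by exact: measurable_itv.
(* Each minimizer is a competitor for the other. *)
have Fuw : fnl u = fnl w.
  apply: le_anti; apply/andP; split; [exact: min_u _ aw|exact: min_w _ au].
have Fu_ge0 : (0 <= fnl u)%E.
  by apply: integral_ge0 => r _; rewrite lee_fin; exact: density_ge0.
have Fu_fin : fnl u \is a fin_num.
  by rewrite (ge0_fin_numE Fu_ge0); case: au.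
have D_ge0 : (0 <= \int[mu]_(r in I01) (vel_gap u w r)%:E)%E.
  by apply: integral_ge0 => r _; rewrite lee_fin vel_gap_ge0.
have := gap_eq0 Fuw Fu_fin D_ge0 (functional_mid au aw)
  (min_u _ (admissible_mid au aw)).
have [[uX _ _ _ _] [wX _ _ _ _]] := (au, aw).
have -> : (\int[mu]_(r in I01) (vel_gap u w r)%:E =
    \int[mu]_(r in I01) `|(EFin \o vel_gap u w) r|)%E.
  by apply: eq_integral => r _; rewrite gee0_abs ?lee_fin ?vel_gap_ge0.
move/(ae_eq_integral_abs mu mD (measurable_vel_gap uX wX)).
apply: filterS => r /[apply] -[] /eqP.
by rewrite mulf_eq0 invr_eq0 pnatr_eq0/= sqrf_eq0 subr_eq0 => /eqP.
Qed.

End uniqueness.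

(** * Recovery of the other components from the velocity *)

Theorem theorem3 (R : realType) (p q lambda tau : R) (phi psi g h : R -> R)
    (u0 : fields R)
    (hp : 1 < p) (hq : 1 < q) (hlambda : 0 < lambda) (htau : 0 < tau)
    (hconst : constitutive p q phi psi g h)
    (hdata : data_conditions p q lambda phi psi g h u0)
    (u w : fields R)
    (hu : minimizer p q lambda tau phi psi g h u0 u)
    (hw : minimizer p q lambda tau phi psi g h u0 w) :
  ae_eq_fields u w.
Proof.
have aeF := ae_filter_ringOfSetsType (@lebesgue_measure R).
have u0X : spaceX p q u0 by case: hdata.
have vuw := minimizer_vel_unique hp hq hconst u0X hu hw.
have [[uX _ _ _ [bu au gu]] _] := hu.
have [[wX _ _ _ [bw aw gw]] _] := hw.
(* The constraint on [beta] involves the weak derivative of the velocity, not the velocity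
   itself. *)
have dvuw : wderiv (vel u) = wderiv (vel w) %[ae lebesgue_measure in `]0, 1[%classic].
  by apply: ae_eq_wderiv vuw; [case: uX => _ _ _ []|case: wX => _ _ _ []].
have tauK (x y z : R) : (x - z) / tau = (y - z) / tau -> x = y.
  have tau0 : tau^-1 != 0 by rewrite invr_eq0 gt_eqF.
  by move=> /(mulIf tau0) /addIr.
(* The right-hand sides of the constraints now agree a.e., and [tauK] cancels the time step and the
   data. *)
split => //.
- apply: filterS3 au aw vuw => r aur awr vr rI.
  by apply: (tauK _ _ (alpha u0 r)); rewrite aur// awr// vr.
- apply: filterS3 bu bw dvuw => r bur bwr vr rI.
  by apply: (tauK _ _ (beta u0 r)); rewrite bur// bwr// vr.
- apply: filterS3 gu gw vuw => r gur gwr vr rI.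
  by apply: (tauK _ _ (gamma u0 r)); rewrite gur// gwr// vr.
Qed.
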